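(* Let $A=((a_{ij}))\in\mathcal M_{3\times 3}(\mathbb C)$ with $\|A\|<1$. Set $x_1=a_{11}$, $x_2=a_{22}$, $x_3=a_{11}a_{22}-a_{12}a_{21}$, $x_4=a_{33}$, $x_5=a_{11}a_{33}-a_{13}a_{31}$, $x_6=a_{22}a_{33}-a_{23}a_{32}$ and $x_7=\det A$. Then $\mathbf x=(x_1,\ldots,x_7)\in G_{E(3;3;1,1,1)}$.
   Context: $\|\cdot\|$ is the operator norm. For a linear subspace $E$ of $\mathcal M_{n\times n}(\mathbb C)$, $\mu_E(B)=1/\inf\{\|X\|: X\in E,\ \det(I-BX)=0\}$, with $\mu_E(B)=0$ if $I-BX$ is nonsingular for all $X\in E$. $E(3;3;1,1,1)$ is the space of $3\times 3$ diagonal matrices, and $G_{E(3;3;1,1,1)}=\{\pi(B): B\in\mathcal M_{3\times3}(\mathbb C),\ \mu_{E(3;3;1,1,1)}(B)<1\}$ where $$\pi(B)=\big(b_{11},\ b_{22},\ b_{11}b_{22}-b_{12}b_{21},\ b_{33},\ b_{11}b_{33}-b_{13}b_{31},\ b_{22}b_{33}-b_{23}b_{32},\ \det B\big).$$ *)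

(* Defs.v *)
From HB Require Import structures.
From mathcomp Require Import all_boot all_order all_algebra.
From mathcomp Require Import boolp classical_sets reals.
From mathcomp Require Import complex.

Set Implicit Arguments.
Unset Strict Implicit.
Unset Printing Implicit Defensive.

Import Order.TTheory GRing.Theory Num.Theory.

Local Open Scope classical_set_scope.
Local Open Scope ring_scope.
Local Open Scope complex_scope.

Definition l2norm (R : realType) (n : nat) (v : 'cV[R[i]]_n) : R :=
  Num.sqrt (\sum_(i < n) ComplexField.Normc.normc (v i 0) ^+ 2).

Definition opnorm (R : realType) (n : nat) (A : 'M[R[i]]_n) : R :=
  sup [set l2norm (A *m v) | v in [set v : 'cV[R[i]]_n | l2norm v <= 1]].

Definition mu (R : realType) (n : nat) (E : {vspace 'M[R[i]]_n})
    (B : 'M[R[i]]_n) : R :=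
  if `[< forall X, X \in E -> 1%:M - B *m X \in unitmx >] then 0
  else 1 / inf [set opnorm X | X in
                 [set X | X \in E /\ \det (1%:M - B *m X) = 0]].

Definition E_3_3_111 (R : realType) : {vspace 'M[R[i]]_3} :=
  limg (linfun (@diag_mx R[i] 3)).

Lemma mem_E_3_3_111 (R : realType) (X : 'M[R[i]]_3) :
  (X \in E_3_3_111 R) = is_diag_mx X.
Proof.
apply/memv_imgP/is_diag_mxP => [[d _ ->] i j ij|dX].
  by rewrite lfunE /= mxE -val_eqE (negbTE ij) mulr0n.
exists (\row_j X j j); first exact: memvf.
apply/matrixP => i j; rewrite lfunE /= !mxE.
have [<-|ij] := eqVneq i j; first by rewrite mulr1n.
by rewrite mulr0n dX.
Qed.

Definition row7 (T : pzRingType) (x1 x2 x3 x4 x5 x6 x7 : T) : 'rV[T]_7 :=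
  \row_(j < 7) [:: x1; x2; x3; x4; x5; x6; x7]`_j.

(* Indices are shifted: b_{11}, b_{22}, b_{33} are B 0 0, B 1 1, B 2 2, where
   0, 1, 2 are the elements of 'I_3 (2 is 1 + 1 in the ring Z/3). *)
Definition pi_G (R : realType) (B : 'M[R[i]]_3) : 'rV[R[i]]_7 :=
  row7 (B 0 0)
       (B 1 1)
       (B 0 0 * B 1 1 - B 0 1 * B 1 0)
       (B 2 2)
       (B 0 0 * B 2 2 - B 0 2 * B 2 0)
       (B 1 1 * B 2 2 - B 1 2 * B 2 1)
       (\det B).

Definition G_E_3_3_111 (R : realType) : set 'rV[R[i]]_7 :=
  [set pi_G B | B in [set B : 'M[R[i]]_3 | mu (E_3_3_111 R) B < 1]].
Arguments G_E_3_3_111 R : clear implicits.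

(* Main.v *)
(* If B X v = v with v nonzero then 1 <= ||B|| ||X||, so every X competing in
   the infimum has norm at least 1/||B||; hence mu_E(B) <= ||B|| for every
   subspace E, and the point x is the image pi(A) of A itself. *)
Require Import Defs.
From mathcomp Require Import all_boot all_order all_algebra.
From mathcomp Require Import boolp classical_sets reals.
From mathcomp Require Import complex.

Import Order.TTheory GRing.Theory Num.Theory.

Local Open Scope ring_scope.
Local Open Scope complex_scope.

Import ComplexField.Normc.

Lemma normc_ge0 {R : rcfType} (x : R[i]) : 0 <= normc x.
Proof. by case: x => a b; exact: sqrtr_ge0. Qed.

Lemma normc_sum {R : rcfType} {I : Type} (s : seq I) (P : pred I)
    (F : I -> R[i]) :
  normc (\sum_(k <- s | P k) F k) <= \sum_(k <- s | P k) normc (F k).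
Proof.
elim/big_rec2: _ => [|k y x _ le_xy]; first by rewrite normc0.
by apply: (le_trans (le_normcD _ _)); rewrite lerD2l.
Qed.

Section OperatorNorm.

Context {R : realType} {n : nat}.
Implicit Types (v : 'cV[R[i]]_n) (A B X : 'M[R[i]]_n).

Lemma l2norm_ge0 v : 0 <= l2norm v.
Proof. exact: sqrtr_ge0. Qed.

Lemma l2normZ (c : R[i]) v : l2norm (c *: v) = normc c * l2norm v.
Proof.
rewrite -(ger0_norm (normc_ge0 c)) -sqrtr_sqr -sqrtrM ?sqr_ge0 // mulr_sumr.
congr Num.sqrt.
by apply: eq_bigr => k _; rewrite mxE normcM exprMn.
Qed.

Lemma normc_le_l2norm v k : normc (v k 0) <= l2norm v.
Proof.
rewrite -(ger0_norm (normc_ge0 (v k 0))) -sqrtr_sqr ler_wsqrtr //.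
by rewrite (bigD1 k) //= lerDl sumr_ge0 // => j _; rewrite sqr_ge0.
Qed.

Lemma l2norm_gt0 v : v != 0 -> 0 < l2norm v.
Proof.
move=> v_neq0; rewrite lt_def l2norm_ge0 andbT; apply: contra v_neq0 => /eqP v0.
apply/eqP/matrixP => k j; rewrite ord1 mxE; apply: eq0_normc; apply/eqP.
by rewrite eq_le normc_ge0 andbT -v0 normc_le_l2norm.
Qed.

(** Boundedness makes [opnorm] a genuine supremum rather than the default value of [sup]. *)
Lemma opnorm_has_ubound A :
  has_ubound [set l2norm (A *m v) | v in [set v | l2norm v <= 1]]%classic.
Proof.
(* On the unit ball every coordinate of [v] has modulus at most 1, so the [k]-th coordinate of
   [A *m v] is bounded by the [k]-th absolute row sum. *)
exists (Num.sqrt (\sum_k (\sum_j normc (A k j)) ^+ 2)) => _ [v /= v1 <-].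
rewrite ler_wsqrtr // ler_sum // => k _.
rewrite lerXn2r ?nnegrE ?normc_ge0 ?sumr_ge0 // => [j _|]; first exact: normc_ge0.
rewrite mxE (le_trans (normc_sum _ _ _)) // ler_sum // => j _.
by rewrite normcM ler_piMr ?normc_ge0 // (le_trans (normc_le_l2norm _ _)).
Qed.

Lemma l2norm_mulmx A v : l2norm (A *m v) <= opnorm A * l2norm v.
Proof.
have [->|/l2norm_gt0 v_gt0] := eqVneq v 0.
  by rewrite mulmx0 -(scale0r 0) l2normZ normc0 mul0r mulr0.
(* By homogeneity it suffices to test the supremum on the unit vector [v / l2norm v]. *)
have normcV : normc ((l2norm v)^-1)%:C = (l2norm v)^-1.
  by rewrite /normc /= expr0n addr0 sqrtr_sqr ger0_norm // invr_ge0 ltW.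
rewrite -ler_pdivrMr // mulrC -normcV -l2normZ scalemxAr.
apply: ub_le_sup; first exact: opnorm_has_ubound.
by exists (((l2norm v)^-1)%:C *: v); rewrite //= l2normZ normcV mulVf ?gt_eqF.
Qed.

Lemma opnorm_ge0 A : 0 <= opnorm A.
Proof.
have l2norm0 : l2norm (0 : 'cV[R[i]]_n) = 0.
  by rewrite -(scale0r 0) l2normZ normc0 mul0r.
apply: ub_le_sup; first exact: opnorm_has_ubound.
(* The zero vector puts the value 0 in the set, which also covers [n = 0]. *)
by exists 0; rewrite /= ?mulmx0 l2norm0 ?ler01.
Qed.

Lemma opnorm_mul_ge1 B X : \det (1%:M - B *m X) = 0 -> 1 <= opnorm B * opnorm X.
Proof.
(* [det0P] yields a row vector in the left kernel; transposing first turns it into a column [w^T]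
   fixed by [B *m X]. *)
move=> detBX; have /eqP/det0P[w w_neq0 wBX] : \det (1%:M - B *m X)^T = 0.
  by rewrite det_tr.
have v_gt0 : 0 < l2norm w^T by rewrite l2norm_gt0 // trmx_eq0.
have vBX : B *m (X *m w^T) = w^T.
  apply/esym/eqP; rewrite mulmxA -subr_eq0 -{1}[w^T]mul1mx -mulmxBl.
  by rewrite -[X in X *m _]trmxK -trmx_mul wBX trmx0.
rewrite -(ler_pM2r v_gt0) mul1r -{1}vBX (le_trans (l2norm_mulmx _ _)) //.
by rewrite -mulrA ler_wpM2l ?opnorm_ge0 ?l2norm_mulmx.
Qed.

Lemma mu_le_opnorm (E : {vspace 'M[R[i]]_n}) B : mu E B <= opnorm B.
Proof.
rewrite /mu; case: asboolP => [_|/existsNP[X0 /not_implyP[X0E X0sing]]].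
  exact: opnorm_ge0.
have det0 : \det (1%:M - B *m X0) = 0.
  by apply/eqP; move/negP: X0sing; rewrite unitmxE unitfE negbK.
(* If [opnorm B] were 0, the singular [X0] would give 1 <= 0. *)
have B_gt0 : 0 < opnorm B.
  rewrite lt_def opnorm_ge0 andbT; apply: contraTneq (opnorm_mul_ge1 _ _ det0).
  by move=> ->; rewrite mul0r ler10.
have le_inf : (opnorm B)^-1 <= inf [set opnorm X | X in
    [set X | X \in E /\ \det (1%:M - B *m X) = 0]]%classic.
  (* [X0] makes the set nonempty, so that [inf] is a true greatest lower bound. *)
  apply: lb_le_inf; first by exists (opnorm X0), X0.
  by move=> _ [X [_ /opnorm_mul_ge1 BX] <-]; rewrite -[_^-1]mulr1 ler_pdivrMl.
(* Inversion reverses the order only between positive numbers; [le_inf] itself supplies the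
   positivity of the infimum. *)
rewrite div1r -[leRHS]invrK lef_pV2 ?posrE ?invr_gt0 //.
by apply: lt_le_trans le_inf; rewrite invr_gt0.
Qed.

End OperatorNorm.

Theorem theorem2p24 (R : realType) (A : 'M[R[i]]_3)
    (x1 x2 x3 x4 x5 x6 x7 : R[i])
    (hA : opnorm A < 1)
    (hx1 : x1 = A 0 0)
    (hx2 : x2 = A 1 1)
    (hx3 : x3 = A 0 0 * A 1 1 - A 0 1 * A 1 0)
    (hx4 : x4 = A 2 2)
    (hx5 : x5 = A 0 0 * A 2 2 - A 0 2 * A 2 0)
    (hx6 : x6 = A 1 1 * A 2 2 - A 1 2 * A 2 1)
    (hx7 : x7 = \det A) :
  G_E_3_3_111 R (row7 x1 x2 x3 x4 x5 x6 x7).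
Proof.
by subst; exists A => //=; apply: le_lt_trans hA; exact: mu_le_opnorm.
Qed.
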